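(* For any two graphs $G$, with distinct vertex labels in $[n]$, and $H$, with distinct vertex labels in $[m]$, we have $$Y_{G\mid H}=Y_G\,Y_H .$$
   Context: All graphs are finite and simple. A graph $G$ with distinct vertex labels in $[n]=\{1,\dots,n\}$ is a graph with $n$ vertices labelled bijectively by $1,\dots,n$; write $v_i$ for the vertex labelled $i$. Let $x_1,x_2,\dots$ be noncommuting variables. A proper colouring of $G$ is a map $\kappa$ from the vertices to $\{1,2,\dots\}$ with $\kappa(u)\ne\kappa(v)$ whenever $u,v$ are adjacent. The chromatic symmetric function in noncommuting variables is $Y_G=\sum_\kappa x_{\kappa(v_1)}x_{\kappa(v_2)}\cdots x_{\kappa(v_n)}\in\mathbb{Q}\langle\langle x_1,x_2,\dots\rangle\rangle$, summed over all proper colourings $\kappa$ of $G$; if $G$ is the empty graph then $Y_G=1$. For $G$ with labels in $[n]$ and $H$ with labels in $[m]$, $G\mid H$ is the disjoint union of $G$ and $H$ labelled by $[n+m]$, where the vertices of $G$ keep their labels in $[n]$ and the vertex of $H$ labelled $j$ receives the label $n+j$. *)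

(* Defs.v *)
From HB Require Import structures.
From mathcomp Require Import all_boot all_order all_algebra.
From mathcomp Require Import boolp classical_sets functions cardinality fsbigop.

Set Implicit Arguments.
Unset Strict Implicit.
Unset Printing Implicit Defensive.

Import GRing.Theory Num.Theory.

Local Open Scope ring_scope.

(* R<<X>>: a series is the function sending a word to its coefficient.  The
   ring product is the Cauchy product over the splittings w = uv, not the
   pointwise one of the function type. *)
Definition ncseries (R : nzRingType) (X : eqType) : Type := seq X -> R.

HB.instance Definition _ (R : nzRingType) (X : eqType) :=
  GRing.Zmodule.copy (ncseries R X) (seq X -> R).

Section NCSeriesRing.
Variables (R : nzRingType) (X : eqType).
Implicit Types (f g h : ncseries R X) (w : seq X).

Definition ncmul f g : ncseries R X :=
  fun w => \sum_(i < (size w).+1) f (take i w) * g (drop i w).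

Definition ncone : ncseries R X := fun w => (w == [::])%:R.

Definition ncvar (x : X) : ncseries R X := fun w => (w == [:: x])%:R.

Let lder (x : X) f : ncseries R X := fun w => f (x :: w).

Let ncmul_nil f g : ncmul f g [::] = f [::] * g [::].
Proof. by rewrite /ncmul big_ord1. Qed.

Let ncmul_cons f g x w :
  ncmul f g (x :: w) = f [::] * g (x :: w) + ncmul (lder x f) g w.
Proof. by rewrite /ncmul big_ord_recl. Qed.

Let ncmulDl : left_distributive ncmul +%R.
Proof.
move=> f g h; apply/funext => w; rewrite /ncmul.
by transitivity (\sum_(i < (size w).+1) (f (take i w) * h (drop i w) +
   g (take i w) * h (drop i w))); [apply: eq_bigr => i _; rewrite -mulrDl
  |rewrite big_split].
Qed.

Let ncmulDr : right_distributive ncmul +%R.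
Proof.
move=> h f g; apply/funext => w; rewrite /ncmul.
by transitivity (\sum_(i < (size w).+1) (h (take i w) * f (drop i w) +
   h (take i w) * g (drop i w))); [apply: eq_bigr => i _; rewrite -mulrDr
  |rewrite big_split].
Qed.

Let ncmulZl (a : R) f g w :
  ncmul (fun u => a * f u) g w = a * ncmul f g w.
Proof. by rewrite /ncmul mulr_sumr; apply: eq_bigr => i _; rewrite mulrA. Qed.

Let ncmulA : associative ncmul.
Proof.
move=> f g h; apply/funext => w; elim: w f g => [|x w IHw] f g.
  by rewrite !ncmul_nil mulrA.
rewrite ncmul_cons IHw !ncmul_cons ncmul_nil mulrDr -addrA -mulrA.
congr (_ + _); rewrite -ncmulZl.
have -> : lder x (ncmul f g) =
    (fun u => f [::] * lder x g u : R) + ncmul (lder x f) g :> ncseries R X.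
  by apply/funext => u; rewrite /lder ncmul_cons.
by rewrite ncmulDl.
Qed.

Let ncmul1l : left_id ncone ncmul.
Proof.
move=> f; apply/funext => w; rewrite /ncmul big_ord_recl take0 drop0 /ncone /=.
rewrite mul1r big1 ?addr0 // => i _.
by case: w i => [[]//|x w] i /=; rewrite mul0r.
Qed.

Let ncmul1r : right_id ncone ncmul.
Proof.
move=> f; apply/funext => w; rewrite /ncmul big_ord_recr /= take_size drop_size.
rewrite /ncone eqxx mulr1 big1 ?add0r // => i _.
by rewrite -size_eq0 size_drop subn_eq0 leqNgt ltn_ord mulr0.
Qed.

Let ncone_neq0 : ncone != 0.
Proof.
apply/eqP => /(congr1 (fun f : ncseries R X => f [::])) /eqP.
by rewrite /ncone eqxx /= oner_eq0.
Qed.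

HB.instance Definition _ := GRing.Zmodule_isNzRing.Build (ncseries R X)
  ncmulA ncmul1l ncmul1r ncmulDl ncmulDr ncone_neq0.

(* Sum of a family of series, in the topology of coefficientwise convergence
   for discrete R.  It is meaningful for families such that every word has a
   nonzero coefficient in finitely many members only: the finitely supported
   sum below is 0 at any other word. *)
Definition ncsum (I : choiceType) (A : set I) (F : I -> ncseries R X) :
  ncseries R X := fun w => \sum_(i \in A) F i w.

Lemma ncmonomialE (s : seq X) w :
  (\prod_(x <- s) ncvar x : ncseries R X) w = (w == s)%:R.
Proof.
elim: s w => [|x s IHs] w; first by rewrite big_nil.
rewrite big_cons -[LHS]/(ncmul (ncvar x) _ w).
case: w => [|y w]; first by rewrite ncmul_nil /ncvar mul0r.
rewrite ncmul_cons {1}/ncvar mul0r add0r /ncmul big_ord_recl take0 drop0 IHs.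
rewrite /lder /ncvar big1 => [|i _].
  by rewrite addr0 -natrM mulnb !eqseq_cons eqxx andbT.
case: w i => [[]//|z w] i /=.
by rewrite eqseq_cons andbF mul0r.
Qed.

End NCSeriesRing.

Record sgraph := SGraph {
  vertex :> finType;
  adj : rel vertex;
  adj_sym : symmetric adj;
  adj_irrefl : irreflexive adj
}.

(* Labels are shifted by one: [vtx i] is the vertex labelled i + 1. *)
Record labelled_graph (n : nat) := LabelledGraph {
  graph :> sgraph;
  vtx : 'I_n -> graph;
  vtx_bij : bijective vtx
}.

Section DisjointUnion.
Variables (n m : nat) (G : labelled_graph n) (H : labelled_graph m).

Definition dunion_adj (u v : G + H) : bool :=
  match u, v with
  | inl x, inl y => adj x y
  | inr x, inr y => adj x y
  | _, _ => false
  end.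

Lemma dunion_adj_sym : symmetric dunion_adj.
Proof. by move=> [x|x] [y|y] //=; apply: adj_sym. Qed.

Lemma dunion_adj_irrefl : irreflexive dunion_adj.
Proof. by move=> [x|x] /=; apply: adj_irrefl. Qed.

(* [fintype.split] sends i < n to [inl i] and n + j to [inr j]. *)
Definition dunion_vtx (i : 'I_(n + m)) : G + H :=
  match fintype.split i with
  | inl j => inl (vtx G j)
  | inr k => inr (vtx H k)
  end.

Lemma dunion_vtx_bij : bijective dunion_vtx.
Proof.
have [[g gK Kg] [h hK Kh]] := (vtx_bij G, vtx_bij H).
exists (fun u => unsplit
  (match u with inl x => inl (g x) | inr y => inr (h y) end)) => [i|u].
  rewrite /dunion_vtx -[RHS](@splitK n m).
  by case: (fintype.split i) => j; rewrite ?gK ?hK.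
by rewrite /dunion_vtx unsplitK; case: u => x; rewrite ?Kg ?Kh.
Qed.

Definition dunion : labelled_graph (n + m) :=
  @LabelledGraph (n + m) (SGraph dunion_adj_sym dunion_adj_irrefl)
    dunion_vtx dunion_vtx_bij.

End DisjointUnion.

Definition colour := {i : nat | (0 < i)%N}.

Definition proper_colouring (G : sgraph) (k : {ffun G -> colour}) : Prop :=
  forall u v : G, adj u v -> k u <> k v.

Definition colouring_monomial (n : nat) (G : labelled_graph n)
    (k : {ffun G -> colour}) : ncseries rat colour :=
  \prod_(i < n) ncvar rat (k (vtx G i)).
Arguments colouring_monomial {n} G k.

Definition chromaticNC (n : nat) (G : labelled_graph n) :
    ncseries rat colour :=
  ncsum [set k | proper_colouring k] (colouring_monomial G).

(* The sum defining [chromaticNC] is well defined: a word is the monomial of at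
   most one colouring. *)
Lemma chromaticNC_summable (n : nat) (G : labelled_graph n) (w : seq colour) :
  finite_set [set k | proper_colouring k /\ colouring_monomial G k w != 0].
Proof.
have monE (k : {ffun G -> colour}) : colouring_monomial G k w != 0 ->
    w = [seq k (vtx G i) | i <- index_enum 'I_n].
  rewrite /colouring_monomial.
  rewrite -(big_map (fun i => k (vtx G i)) predT (@ncvar rat colour)).
  rewrite ncmonomialE.
  by rewrite pnatr_eq0 eqb0 negbK => /eqP.
set A := (X in finite_set X).
have [->|/set0P[k0 [_ /monE wk0]]] := eqVneq A set0; first exact: finite_set0.
apply: (@sub_finite_set _ _ [set k0]); last exact: finite_set1.
move=> k [_ /monE]; rewrite wk0 => /eq_in_map eqk.
have [g _ Kg] := vtx_bij G.
by apply/ffunP => u; rewrite -(Kg u) -eqk ?mem_index_enum.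
Qed.

(* Main.v *)
Require Import Defs.
From mathcomp Require Import all_boot all_order all_algebra.
From mathcomp Require Import boolp classical_sets functions cardinality fsbigop.

(** The coefficient of [Y_G] at a word [w] is 1 if [w] lists the colours of a
    proper colouring of [G], and 0 otherwise. A word does so for [G | H] exactly
    when its prefix of length [n] does so for [G] and the remaining suffix for
    [H]; as all words in the support of [Y_G] have length [n], this is the only
    splitting that contributes to the Cauchy product. *)

Import GRing.Theory.

Local Open Scope ring_scope.

(** After [val], both sides become [iota 0 (n + m)], cut at [n]. This is what cuts a colour word of
    [dunion G H] into its two blocks. *)
Lemma enum_ordD (n m : nat) :
  enum 'I_(n + m) =
  [seq lshift m i | i <- enum 'I_n] ++ [seq rshift n j | j <- enum 'I_m].
Proof.
apply: (inj_map val_inj); rewrite map_cat val_enum_ord iotaD add0n.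
rewrite -(map_comp val (@lshift n m)) -(map_comp val (@rshift n m)).
rewrite -{1}(val_enum_ord n) -[n in iota n m]addn0 iotaDl -val_enum_ord.
by rewrite -map_comp.
Qed.

Definition colour_word (n : nat) (G : labelled_graph n)
    (k : {ffun G -> colour}) : seq colour :=
  [seq k (vtx G i) | i <- enum 'I_n].
Arguments colour_word {n} G k.

Lemma size_colour_word (n : nat) (G : labelled_graph n)
    (k : {ffun G -> colour}) : size (colour_word G k) = n.
Proof. by rewrite size_map size_enum_ord. Qed.

Lemma colour_word_inj (n : nat) (G : labelled_graph n) :
  injective (colour_word G).
Proof.
move=> k l /eq_in_map eqkl; apply/ffunP => u.
by have [g _ gK] := vtx_bij G; rewrite -(gK u) eqkl ?mem_enum.
Qed.

Lemma colouring_monomialE (n : nat) (G : labelled_graph n)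
    (k : {ffun G -> colour}) (w : seq colour) :
  colouring_monomial G k w = (w == colour_word G k)%:R.
Proof.
rewrite /colouring_monomial.
rewrite -(big_map (fun i => k (vtx G i)) predT (@ncvar rat colour)).
by rewrite ncmonomialE /colour_word enumT.
Qed.

Definition proper_word (n : nat) (G : labelled_graph n) (w : seq colour) :=
  exists2 k : {ffun G -> colour}, proper_colouring k & w = colour_word G k.
Arguments proper_word {n} G w.

Lemma size_proper_word (n : nat) (G : labelled_graph n) (w : seq colour) :
  proper_word G w -> size w = n.
Proof. by case=> k _ ->; apply: size_colour_word. Qed.

Lemma chromaticNCE (n : nat) (G : labelled_graph n) (w : seq colour) :
  chromaticNC G w = (`[< proper_word G w >])%:R.
Proof.
rewrite /chromaticNC /ncsum; case: asboolP => [[k kP wk]|wP].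
  (* By [colour_word_inj], no other colouring has the word [w], so the sum shrinks to the single
     index [k]. *)
  rewrite -(@fsbig_widen _ _ _ _ [set k]%classic) => [|l -> //|l [_ /= lk]].
    by rewrite fsbig_set1 colouring_monomialE wk eqxx.
  rewrite colouring_monomialE wk; case: eqP => // /colour_word_inj kl.
  by case: lk.
apply: fsbig1 => k kP; rewrite colouring_monomialE; case: eqP => // wk.
by case: wP; exists k.
Qed.

(** Restriction and gluing match colourings of the disjoint union with pairs of colourings, and
    properness is preserved since no edge joins the two sides. The length of [u] forces the cut to
    fall between the two blocks. *)
Lemma proper_word_dunion (n m : nat) (G : labelled_graph n)
    (H : labelled_graph m) (u v : seq colour) : size u = n ->
  proper_word (dunion G H) (u ++ v) <-> proper_word G u /\ proper_word H v.
Proof.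
have colour_wordD (k : {ffun dunion G H -> colour}) :
    colour_word (dunion G H) k =
    colour_word G [ffun x => k (inl x)] ++ colour_word H [ffun y => k (inr y)].
  rewrite /colour_word enum_ordD map_cat.
  rewrite -(map_comp _ (@lshift n m)) -(map_comp _ (@rshift n m)).
  congr (_ ++ _); apply: eq_map => i /=; rewrite ffunE /dunion_vtx.
    (* Exposing [unsplit] lets the [split] inside [dunion_vtx] cancel. *)
    by rewrite -[lshift m i]/(unsplit (inl i)) unsplitK.
  by rewrite -[rshift n i]/(unsplit (inr i)) unsplitK.
move=> szu; split=> [[k kP /eqP]|[[k kP uk] [l lP vl]]].
  rewrite colour_wordD eqseq_cat ?size_colour_word // => /andP[/eqP-> /eqP->].
  split.
    by exists [ffun x => k (inl x)] => // x y xy; rewrite !ffunE; apply: kP.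
  by exists [ffun y => k (inr y)] => // x y xy; rewrite !ffunE; apply: kP.
exists [ffun x => match x with inl y => k y | inr y => l y end].
  by move=> [x|x] [y|y] //= xy; rewrite !ffunE; [apply: kP|apply: lP].
rewrite colour_wordD uk vl; congr (colour_word G _ ++ colour_word H _);
  by apply/ffunP => x; rewrite !ffunE.
Qed.

Theorem proposition3p5 (n m : nat) (G : labelled_graph n)
    (H : labelled_graph m) :
  chromaticNC (dunion G H) = chromaticNC G * chromaticNC H.
Proof.
apply/funext => w; rewrite -[RHS]/(ncmul (chromaticNC G) (chromaticNC H) w).
have size_take_le (i : 'I_(size w).+1) : size (take i w) = i.
  by rewrite size_takel // -ltnS.
rewrite chromaticNCE /ncmul; have [szw|szw] := leqP n (size w).
  (* Isolate the cut at [n]; at any other cut the prefix has the wrong length for [G]. *)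
  rewrite (bigD1 (Ordinal (szw : (n < (size w).+1)%N))) //= big1 => [|i i_n].
    rewrite addr0 !chromaticNCE -natrM mulnb -asbool_and.
    rewrite -{1}(cat_take_drop n w); congr (nat_of_bool _)%:R.
    by apply: asbool_equiv_eq; apply: proper_word_dunion; rewrite size_takel.
  rewrite chromaticNCE asboolF ?mul0r // => /size_proper_word.
  by rewrite size_take_le => i_eq; case/eqP: i_n; apply: val_inj.
(* Here [w] is shorter than [n]: it is too short for the union, and so is each of its prefixes for
   [G], hence both sides vanish. *)
rewrite asboolF => [|/size_proper_word wE]; last first.
  by move: szw; rewrite wE ltnNge leq_addr.
rewrite big1 // => i _; rewrite chromaticNCE asboolF ?mul0r //.
move=> /size_proper_word; rewrite size_take_le => i_eq.
by have := leq_ltn_trans (ltn_ord i : (i <= size w)%N) szw; rewrite i_eq ltnn.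
Qed.
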